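(* For every player set $N=\{1,2,\ldots,n\}$ with $|N|>1$, the following assertions hold: (i) $\mathrm{SeSIG}^N \not\subseteq \mathrm{SIG}^N$; (ii) $\mathrm{SIG}^N \not\subseteq \mathrm{SeSIG}^N$; (iii) $\mathrm{SeSIG}^N \cap \mathrm{SIG}^N \neq \emptyset$.
   Context: Let $2^N$ be the power set of $N$ and $\mathbb{IR}$ the set of all closed real intervals $X=[\underline{X},\overline{X}]$. Interval addition is $X+Y=[\underline{X}+\underline{Y},\overline{X}+\overline{Y}]$, and $I\preceq J$ means $\underline{I}\le\underline{J}$ and $\overline{I}\le\overline{J}$. A (classical) cooperative game is a pair $(N,v)$ with $v:2^N\to\mathbb{R}$ and $v(\emptyset)=0$; it is superadditive if $v(T)+v(S)\le v(S\cup T)$ for every $S,T\subseteq N$ with $S\cap T=\emptyset$. A cooperative interval game is a pair $(N,w)$ with $w:2^N\to\mathbb{IR}$ and $w(\emptyset)=[0,0]$. Write $\underline{w}(S)$, $\overline{w}(S)$ for the lower and upper bound of $w(S)$. The length game of $(N,w)$ is the cooperative game $(N,|w|)$ with $|w|(S)=\overline{w}(S)-\underline{w}(S)$. A selection of $(N,w)$ is a cooperative game $(N,v)$ with $v(S)\in w(S)$ for every $S\in 2^N$. $\mathrm{SIG}^N$ is the class of superadditive interval games on player set $N$: interval games $(N,w)$ such that $w(T)+w(S)\preceq w(S\cup T)$ for every $S,T\subseteq N$ with $S\cap T=\emptyset$, and whose length game is superadditive. $\mathrm{SeSIG}^N$ is the class of selection superadditive interval games on player set $N$: interval games all of whose selections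 are superadditive. *)

(* Defs.v *)
From mathcomp Require Import all_boot all_order all_algebra.
From mathcomp Require Import classical_sets reals.

Set Implicit Arguments.
Unset Strict Implicit.
Unset Printing Implicit Defensive.

Import Order.TTheory GRing.Theory Num.Theory.
Local Open Scope ring_scope.

(* Intervals are nonempty, hence determined by their bounds. *)
Record closed_itv (R : realType) := ClosedItv {
  lower : R;
  upper : R;
  lower_le_upper : lower <= upper
}.

Definition itv_of (R : realType) (X : closed_itv R) : interval R :=
  `[lower X, upper X].

Definition itv_zero (R : realType) : closed_itv R := ClosedItv (lexx (0 : R)).

Definition itv_add (R : realType) (X Y : closed_itv R) : closed_itv R :=
  ClosedItv (lerD (lower_le_upper X) (lower_le_upper Y)).

Definition itv_preceq (R : realType) (X Y : closed_itv R) : Prop :=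
  lower X <= lower Y /\ upper X <= upper Y.

(* finset.set0 is the empty coalition; unqualified set0 is the one of
   classical_sets. *)
Record game (R : realType) (N : finType) := Game {
  game_fun :> {set N} -> R;
  game_set0 : game_fun finset.set0 = 0
}.

Definition superadditive (R : realType) (N : finType) (v : game R N) : Prop :=
  forall S T : {set N}, [disjoint S & T] -> v T + v S <= v (S :|: T).

Record interval_game (R : realType) (N : finType) := IntervalGame {
  interval_game_fun :> {set N} -> closed_itv R;
  interval_game_set0 : interval_game_fun finset.set0 = itv_zero R
}.

Lemma length_set0 (R : realType) (N : finType) (w : interval_game R N) :
  upper (w finset.set0) - lower (w finset.set0) = 0.
Proof. by rewrite interval_game_set0 subrr. Qed.

Definition length_game (R : realType) (N : finType) (w : interval_game R N) :
    game R N :=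
  @Game R N (fun S => upper (w S) - lower (w S)) (length_set0 w).

Definition selection (R : realType) (N : finType) (w : interval_game R N)
    (v : game R N) : Prop :=
  forall S : {set N}, v S \in itv_of (w S).

Definition itv_superadditive (R : realType) (N : finType)
    (w : interval_game R N) : Prop :=
  forall S T : {set N}, [disjoint S & T] ->
    itv_preceq (itv_add (w T) (w S)) (w (S :|: T)).

Definition SIG (R : realType) (N : finType) : set (interval_game R N) :=
  [set w | itv_superadditive w /\ superadditive (length_game w)]%classic.

Definition SeSIG (R : realType) (N : finType) : set (interval_game R N) :=
  [set w | forall v : game R N, selection w v -> superadditive v]%classic.

Arguments SIG : clear implicits.
Arguments SeSIG : clear implicits.

(* Main.v *)
(** Let singletons carry [[0, 1]] and every other coalition the degenerate
    interval [[#|S|, #|S|]]: the values of two nonempty disjoint coalitions add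
    up to at most [#|S :|: T|], which is the forced value of the union, but two
    singletons have total length 2 inside a pair of length 0.  Conversely
    [[0, #|S|]] is superadditive with additive length, yet it has a selection
    equal to 1 on a single singleton and 0 elsewhere.  The zero game is in both
    classes. *)
Require Import Defs.
From mathcomp Require Import all_boot all_order all_algebra.
From mathcomp Require Import classical_sets reals zify.

Import Order.TTheory GRing.Theory Num.Theory.

Local Open Scope ring_scope.

(** The order is boolean, so two proofs that the same bounds are ordered coincide. *)
Lemma closed_itv_inj (R : realType) (X Y : closed_itv R) :
  lower X = lower Y -> upper X = upper Y -> X = Y.
Proof.
case: X Y => [a b ab] [c d cd] /= ac bd; rewrite -ac -bd in cd *.
by rewrite (bool_irrelevance ab cd).
Qed.

(** Each example below is known only through its two bound functions, which keeps the order proofs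
    stored in the intervals out of the computations. *)
Lemma interval_game_of_bounds (R : realType) (N : finType)
    (l u : {set N} -> R) :
  (forall S, l S <= u S) -> l finset.set0 = 0 -> u finset.set0 = 0 ->
  exists w : interval_game R N,
    forall S, lower (w S) = l S /\ upper (w S) = u S.
Proof.
move=> lu l0 u0.
have w0 : ClosedItv (lu finset.set0) = itv_zero R by exact: closed_itv_inj.
by exists (IntervalGame (interval_game_fun := fun S => ClosedItv (lu S)) w0).
Qed.

Lemma selectionP (R : realType) (N : finType) (w : interval_game R N)
    (v : game R N) :
  selection w v <-> forall S, lower (w S) <= v S <= upper (w S).
Proof. by split=> vw S; have := vw S; rewrite /itv_of itv_boundlr. Qed.

Lemma card_disjointU (N : finType) (S T : {set N}) :
  [disjoint S & T] -> #|S :|: T| = (#|S| + #|T|)%N.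
Proof. by move=> dST; apply/eqP; rewrite (leq_card_setU S T).2. Qed.

Lemma natr_card_disjointU (R : realType) (N : finType) (S T : {set N}) :
  [disjoint S & T] -> #|S :|: T|%:R = #|T|%:R + #|S|%:R :> R.
Proof. by move/card_disjointU ->; rewrite addnC natrD. Qed.

Section Classes.
Variables (R : realType) (N : finType).

Lemma SeSIG_not_sub_SIG : (1 < #|N|)%N -> ~ (SeSIG R N `<=` SIG R N)%classic.
Proof.
move=> /card_gt1P[x [y [_ _ xy]]].
pose l (S : {set N}) : R := if #|S| == 1%N then 0 else #|S|%:R.
have [||//|w wE] := @interval_game_of_bounds R N l (fun S => #|S|%:R).
- by move=> S; rewrite /l; case: ifP => _; rewrite ?ler0n.
- by rewrite /l cards0.
- by rewrite cards0.
have dxy : [disjoint [set x] & [set y]] by rewrite disjoints1 inE.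
move=> /(_ w)[|_ /(_ _ _ dxy)].
  move=> v /selectionP vw S T dST.
  (* Empty coalitions are set aside: the union could then be a singleton, whose lower bound 0 bounds
     nothing. *)
  have [->|S0] := eqVneq S finset.set0.
    by rewrite game_set0 addr0 finset.set0U.
  have [->|T0] := eqVneq T finset.set0.
    by rewrite game_set0 add0r finset.setU0.
  (* The union now has at least two elements, so its lower bound is its cardinality, the sum of the
     upper bounds at [S] and [T]. *)
  have cU : #|S :|: T| != 1%N.
    by rewrite card_disjointU //; move: S0 T0; rewrite -!card_gt0; lia.
  have /andP[+ _] := vw (S :|: T).
  rewrite (wE _).1 /l (negbTE cU) natr_card_disjointU //.
  apply: le_trans; apply: lerD.
  - by have /andP[_] := vw T; rewrite (wE _).2.
  - by have /andP[_] := vw S; rewrite (wE _).2.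
(* On the two singletons, superadditivity of the length would give [1 + 1 <= 2 - 2]. *)
rewrite /= !(wE _).1 !(wE _).2 /l !cards1 cards2 xy /=.
by rewrite subrr !subr0 -natrD lern0.
Qed.

Lemma SIG_not_sub_SeSIG : (1 < #|N|)%N -> ~ (SIG R N `<=` SeSIG R N)%classic.
Proof.
move=> /card_gt1P[x [y [_ _ xy]]].
have [|//||w wE] := @interval_game_of_bounds R N (fun=> 0) (fun S => #|S|%:R).
- by move=> S; rewrite ler0n.
- by rewrite cards0.
have dxy : [disjoint [set x] & [set y]] by rewrite disjoints1 inE.
(* This selection drops from 1 to 0 when [y] joins [x]. *)
pose f (S : {set N}) : R := (S == [set x])%:R.
have f0 : f finset.set0 = 0.
  by rewrite /f eq_sym -cards_eq0 cards1.
have wSIG : SIG R N w.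
  split=> S T dST; rewrite /itv_preceq /= !(wE _).1 !(wE _).2.
    by rewrite natr_card_disjointU // addr0.
  by rewrite natr_card_disjointU // !subr0.
have fsel : selection w (Game f0).
  apply/selectionP => S; rewrite (wE _).1 (wE _).2 /= /f ler0n ler_nat.
  by case: eqP => [->|//]; rewrite cards1.
move=> /(_ w wSIG (Game f0) fsel _ _ dxy); rewrite /= /f eqxx.
have -> : ([set y] == [set x]) = false.
  by rewrite (inj_eq finset.set1_inj) eq_sym (negbTE xy).
have -> : ([set x] :|: [set y] == [set x]) = false.
  by apply/eqP => /(congr1 (fun A : {set N} => #|A|)); rewrite cards2 cards1 xy.
by rewrite add0r ler10.
Qed.

Lemma SeSIG_meets_SIG : (SeSIG R N `&` SIG R N !=set0)%classic.
Proof.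
have [//|//|//|w wE] := @interval_game_of_bounds R N (fun=> 0) (fun=> 0).
exists w; split=> [v /selectionP vw S T _|].
  (* Degenerate intervals leave a single selection. *)
  have v0 A : v A = 0.
    by apply/esym/le_anti; have := vw A; rewrite (wE A).1 (wE A).2.
  by rewrite !v0 addr0.
by split=> S T _; rewrite /itv_preceq /= !(wE _).1 !(wE _).2 ?subr0 addr0.
Qed.

End Classes.

Local Open Scope classical_set_scope.

Theorem theorem5 (R : realType) (n : nat) (hn : (1 < n)%N) :
  [/\ ~ (SeSIG R 'I_n `<=` SIG R 'I_n),
      ~ (SIG R 'I_n `<=` SeSIG R 'I_n)
    & SeSIG R 'I_n `&` SIG R 'I_n !=set0].
Proof.
have cardN : (1 < #|'I_n|)%N by rewrite card_ord.
split; [exact: SeSIG_not_sub_SIG | exact: SIG_not_sub_SeSIG |].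
exact: SeSIG_meets_SIG.
Qed.
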